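(* Let $\mathcal{X}\subset\mathbb{R}^d$ be nonempty, convex and compact with diameter at most $D$ (i.e. $\|\mathbf{x}-\mathbf{y}\|\le D$ for all $\mathbf{x},\mathbf{y}\in\mathcal{X}$), and let $f:\mathcal{X}\to\mathbb{R}$ be convex and differentiable with $L$-Lipschitz gradient on $\mathcal{X}$, i.e. $\|\nabla f(\mathbf{x})-\nabla f(\mathbf{y})\|_*\le L\|\mathbf{x}-\mathbf{y}\|$ for all $\mathbf{x},\mathbf{y}\in\mathcal{X}$. Run Frank-Wolfe with heavy ball momentum (HFW) with, for all $k\ge 0$, $$\delta_k=\frac{2}{k+2},\qquad \eta_k\in\arg\min_{\eta\in[0,1]}f\big((1-\eta)\mathbf{x}_k+\eta\mathbf{v}_{k+1}\big).$$ Then the generalized FW gap satisfies $$\mathcal{G}_k=f(\mathbf{x}_k)-\Phi_k(\mathbf{v}_k)\le\frac{2LD^2}{k+1},\qquad\forall k\ge 1.$$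
   Context: $\|\cdot\|$ is a norm on $\mathbb{R}^d$, $\|\cdot\|_*$ its dual norm, $\langle\cdot,\cdot\rangle$ the inner product. HFW with parameters $\delta_k,\eta_k\in[0,1]$: start from any $\mathbf{x}_0\in\mathcal{X}$ and $\mathbf{g}_0=\nabla f(\mathbf{x}_0)$; for $k=0,1,2,\dots$ set $\mathbf{g}_{k+1}=(1-\delta_k)\mathbf{g}_k+\delta_k\nabla f(\mathbf{x}_k)$, let $\mathbf{v}_{k+1}$ be any element of $\arg\min_{\mathbf{v}\in\mathcal{X}}\langle\mathbf{g}_{k+1},\mathbf{v}\rangle$, and set $\mathbf{x}_{k+1}=(1-\eta_k)\mathbf{x}_k+\eta_k\mathbf{v}_{k+1}$. Weights: $w_k^\tau=\delta_\tau\prod_{j=\tau+1}^k(1-\delta_j)$ for $1\le\tau\le k$ and $w_k^0=\prod_{j=1}^k(1-\delta_j)$ (empty products equal $1$), so that $\mathbf{g}_{k+1}=\sum_{\tau=0}^k w_k^\tau\nabla f(\mathbf{x}_\tau)$. For $k\ge 0$ define $$\Phi_{k+1}(\mathbf{x})=\sum_{\tau=0}^k w_k^\tau\big[f(\mathbf{x}_\tau)+\langle\nabla f(\mathbf{x}_\tau),\mathbf{x}-\mathbf{x}_\tau\rangle\big].$$ The generalized FW gap is, for $k\ge 1$, $\mathcal{G}_k=f(\mathbf{x}_k)-\min_{\mathbf{x}\in\mathcal{X}}\Phi_k(\mathbf{x})=f(\mathbf{x}_k)-\Phi_k(\mathbf{v}_k)$. *)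

(* Defs.v *)
(* Vectors of R^d are row vectors 'rV[R]_d. *)
From HB Require Import structures.
From mathcomp Require Export all_boot all_order all_algebra.
From mathcomp Require Export all_classical all_reals all_analysis.
Set Implicit Arguments.
Unset Strict Implicit.
Unset Printing Implicit Defensive.
Export Order.TTheory GRing.Theory Num.Theory.
Export numFieldNormedType.Exports.
Global Open Scope classical_set_scope.
Global Open Scope ring_scope.

(* An arbitrary norm on R^d.  The library's canonical norm `|_| on matrices is
   the max norm; it is used below only as the standard topology of R^d. *)
Record is_norm (R : realType) (d : nat) (N : 'rV[R]_d -> R) : Prop := IsNorm {
  is_norm_triangle : forall u v, N (u + v) <= N u + N v ;
  is_norm_homog : forall a u, N (a *: u) = `|a| * N u ;
  is_norm_definite : forall u, N u = 0 -> u = 0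
}.

Definition dotp (R : realType) (d : nat) (u v : 'rV[R]_d) : R :=
  \sum_(i < d) u ord0 i * v ord0 i.

Definition dual_norm (R : realType) (d : nat) (N : 'rV[R]_d -> R)
    (u : 'rV[R]_d) : R :=
  sup [set dotp u v | v in [set v | N v <= 1]].

Definition argmin (R : realType) (T : Type) (A : set T) (F : T -> R) : set T :=
  [set a | A a /\ forall b, A b -> F a <= F b].

(* Differentiability at x of a function with domain X, with gradient p:
   f y = f x + <p, y - x> + o(y - x) as y tends to x inside X.  Values of f
   outside X are irrelevant.  The choice of norm in the o() is immaterial since
   all norms on R^d are equivalent. *)
Definition gradient_on (R : realType) (d : nat) (X : set 'rV[R]_d)
    (f : 'rV[R]_d -> R) (x p : 'rV[R]_d) : Prop :=
  (fun y => f y - f x - dotp p (y - x) : R^o)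
    =o_ (within X (nbhs x)) (fun y => y - x).

Section HFW.
Variables (R : realType) (d : nat) (X : set 'rV[R]_d).
Variables (f : 'rV[R]_d -> R) (gradf : 'rV[R]_d -> 'rV[R]_d).
Variables (delta eta : nat -> R).
Variables (x g v : nat -> 'rV[R]_d).

(* v 0 is not part of the algorithm and is left unconstrained. *)
Record HFW : Prop := IsHFW {
  HFW_delta : forall k, 0 <= delta k <= 1 ;
  HFW_eta : forall k, 0 <= eta k <= 1 ;
  HFW_x0 : X (x 0) ;
  HFW_g0 : g 0 = gradf (x 0) ;
  HFW_g : forall k,
    g k.+1 = (1 - delta k) *: g k + delta k *: gradf (x k) ;
  HFW_v : forall k, argmin X (dotp (g k.+1)) (v k.+1) ;
  HFW_x : forall k,
    x k.+1 = (1 - eta k) *: x k + eta k *: v k.+1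
}.

(* hb_weight k tau is w_k^tau, for tau <= k. *)
Definition hb_weight (k tau : nat) : R :=
  if tau == 0%N then \prod_(1 <= j < k.+1) (1 - delta j)
  else delta tau * \prod_(tau.+1 <= j < k.+1) (1 - delta j).

(* Phi k uses the weights w_(k-1)^tau, tau = 0, ..., k-1; it is meaningful for
   k >= 1 only. *)
Definition Phi (k : nat) (z : 'rV[R]_d) : R :=
  \sum_(0 <= tau < k) hb_weight k.-1 tau *
    (f (x tau) + dotp (gradf (x tau)) (z - x tau)).

Definition fw_gap (k : nat) : R := f (x k) - inf [set Phi k z | z in X].

End HFW.

(* Main.v *)
(* Each [Phi k] is affine with linear part [g k], so [v k] minimizes it over [X]
   and [Phi k (v k)] is the minimum.  Writing [G k] for the gap, the recursion
   [Phi (k+1) = (1 - delta k) Phi k + delta k (linearization at x k)], the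
   minimality of [v k] and the quadratic upper bound for [f] at the step size
   [delta k] (the line search does at least as well) give
   [G (k+1) <= (1 - delta k) G k + delta k ^ 2 L D^2 / 2],
   and [delta k = 2 / (k + 2)] turns this into the rate [2 L D^2 / (k + 1)]. *)
Require Import Defs.
From mathcomp Require Import ring lra.
Set Implicit Arguments.
Unset Strict Implicit.
Unset Printing Implicit Defensive.

(** * Bilinearity of the inner product *)

Lemma dotpDl (R : realType) (d : nat) (u v w : 'rV[R]_d) :
  dotp (u + v) w = dotp u w + dotp v w.
Proof.
by rewrite /dotp -big_split; apply: eq_bigr => i _; rewrite mxE mulrDl.
Qed.

Lemma dotpZl (R : realType) (d : nat) (a : R) (u v : 'rV[R]_d) :
  dotp (a *: u) v = a * dotp u v.
Proof.
by rewrite /dotp mulr_sumr; apply: eq_bigr => i _; rewrite mxE mulrA.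
Qed.

Lemma dotpC (R : realType) (d : nat) (u v : 'rV[R]_d) : dotp u v = dotp v u.
Proof. by apply: eq_bigr => i _; rewrite mulrC. Qed.

Lemma dotpBl (R : realType) (d : nat) (u v w : 'rV[R]_d) :
  dotp (u - v) w = dotp u w - dotp v w.
Proof. by rewrite dotpDl -scaleN1r dotpZl mulN1r. Qed.

Lemma dotpZr (R : realType) (d : nat) (a : R) (u v : 'rV[R]_d) :
  dotp u (a *: v) = a * dotp u v.
Proof. by rewrite dotpC dotpZl dotpC. Qed.

Lemma dotpBr (R : realType) (d : nat) (u v w : 'rV[R]_d) :
  dotp u (v - w) = dotp u v - dotp u w.
Proof. by rewrite dotpC dotpBl !(dotpC u). Qed.

(** * Arbitrary norms against the max norm, and duality *)

Lemma norm_coord_le (R : realType) (d : nat) (u : 'rV[R]_d) (i : 'I_d) :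
  `|u ord0 i| <= `|u|.
Proof.
rewrite [leRHS]/Num.norm /= mx_normrE; apply/bigmax_geP; right.
by exists (ord0, i).
Qed.

Lemma dotp_le_sum (R : realType) (d : nat) (u v : 'rV[R]_d) :
  dotp u v <= (\sum_(i < d) `|u ord0 i|) * `|v|.
Proof.
rewrite mulr_suml; apply: ler_sum => i _; apply: le_trans (ler_norm _) _.
by rewrite normrM ler_wpM2l ?norm_coord_le.
Qed.

Lemma is_norm0 (R : realType) (d : nat) (N : 'rV[R]_d -> R) :
  is_norm N -> N 0 = 0.
Proof. by move=> hN; rewrite -(scale0r 0) is_norm_homog // normr0 mul0r. Qed.

Lemma is_normN (R : realType) (d : nat) (N : 'rV[R]_d -> R) (u : 'rV[R]_d) :
  is_norm N -> N (- u) = N u.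
Proof. by move=> hN; rewrite -scaleN1r is_norm_homog // normrN1 mul1r. Qed.

Lemma is_norm_ge0 (R : realType) (d : nat) (N : 'rV[R]_d -> R) (u : 'rV[R]_d) :
  is_norm N -> 0 <= N u.
Proof.
move=> hN; have := is_norm_triangle hN u (- u).
by rewrite subrr (is_norm0 hN) is_normN // -mulr2n pmulrn_lge0.
Qed.

Lemma is_norm_le_norm (R : realType) (d : nat) (N : 'rV[R]_d -> R)
    (u : 'rV[R]_d) :
  is_norm N -> N u <= (\sum_(i < d) N (delta_mx ord0 i)) * `|u|.
Proof.
move=> hN; rewrite {1}(row_sum_delta u) mulr_suml.
apply: (big_ind2 (fun a b => N a <= b)) => [|a b c e ab ce|i _].
- by rewrite is_norm0.
- by apply: le_trans (is_norm_triangle hN _ _) _; apply: lerD.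
- by rewrite is_norm_homog // mulrC ler_wpM2l ?is_norm_ge0 ?norm_coord_le.
Qed.

(** The reverse triangle inequality makes [N] Lipschitz for the max norm. *)
Lemma is_norm_continuous (R : realType) (d : nat) (N : 'rV[R]_d -> R) :
  is_norm N -> continuous N.
Proof.
move=> hN u; set C := \sum_(i < d) N (delta_mx ord0 i).
have C0 : 0 <= C by apply: sumr_ge0 => i _; exact: is_norm_ge0.
have Nlip v : `|N u - N v| <= C * `|u - v|.
  have duv := is_norm_triangle hN (u - v) v.
  have dvu := is_norm_triangle hN (v - u) u.
  have bnd := is_norm_le_norm (u - v) hN.
  have sym := is_normN (u - v) hN.
  rewrite opprB in sym; rewrite !subrK in duv dvu.
  by rewrite ler_norml; apply/andP; split; rewrite -/C in bnd; lra.
apply/(@cvgrPdist_lt _ _ _ (nbhs u) (nbhs_filter u)) => e e0.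
have C1 : 0 < C + 1 by rewrite ltr_wpDl.
apply/nbhs_ballP; exists ((C + 1)^-1 * e) => [|v].
  by rewrite /= mulr_gt0 ?invr_gt0.
rewrite -ball_normE /ball_ /= ltr_pdivlMl //; apply: le_lt_trans.
by apply: le_trans (Nlip v) _; rewrite ler_wpM2r // lerDl.
Qed.

(** The unit sphere of the max norm is compact, so [N] attains there a minimum, positive by
    definiteness; homogeneity extends the bound to all vectors. *)
Lemma norm_le_is_norm (R : realType) (d : nat) (N : 'rV[R]_d -> R) :
  is_norm N -> exists2 c : R, 0 < c & forall u, c * `|u| <= N u.
Proof.
move=> hN; pose S : set 'rV[R]_d := [set u | `|u| = 1].
have normS u : u != 0 -> S (`|u|^-1 *: u).
  by move=> u0; rewrite /S /= normrZ normfV normr_id mulVf ?normr_eq0.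
(* If the sphere is empty, normalization shows that every vector is zero, and any positive constant
   works. *)
have [S0|/set0P S0] := eqVneq S set0.
  exists 1 => // u; have [->|/normS] := eqVneq u 0.
    by rewrite normr0 mulr0 is_norm0.
  by rewrite S0.
have Scompact : compact S.
  apply: bounded_closed_compact.
    by exists 1; split => // M M1 u /= ->; exact: ltW.
  apply: (@closed_comp _ _ (fun u : 'rV[R]_d => `|u|) [set 1 : R]).
    by move=> u _; exact: norm_continuous.
  exact: closed_eq.
have Ncont := continuous_subspaceT (is_norm_continuous hN).
have [w] := EVT_min_rV S0 Scompact (Ncont S).
rewrite inE => Sw wmin.
have Nw : 0 < N w.
  rewrite lt_neqAle is_norm_ge0 // andbT eq_sym.
  apply/eqP => /(is_norm_definite hN) w0.
  by move: Sw; rewrite /S /= w0 normr0 => /esym/eqP; rewrite oner_eq0.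
exists (N w) => // u; have [->|u0] := eqVneq u 0.
  by rewrite normr0 mulr0 is_norm0.
have := wmin _ (mem_set (normS _ u0)).
by rewrite is_norm_homog // normfV normr_id ler_pdivlMl ?normr_gt0 // mulrC.
Qed.

(** After scaling [v] to unit [N]-norm, the inner product belongs to the set whose [sup] is the dual
    norm; norm equivalence bounds that set, so its [sup] is a true upper bound. *)
Lemma dotp_le_dual_norm (R : realType) (d : nat) (N : 'rV[R]_d -> R)
    (u v : 'rV[R]_d) :
  is_norm N -> dotp u v <= dual_norm N u * N v.
Proof.
move=> hN; have [->|v0] := eqVneq v 0.
  by rewrite (is_norm0 hN) mulr0 -(scale0r 0) dotpZr mul0r.
have Nv : 0 < N v.
  rewrite lt_neqAle is_norm_ge0 // andbT eq_sym.
  by apply: contra_neq v0; exact: is_norm_definite.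
rewrite -ler_pdivrMr // mulrC -dotpZr; apply: ub_le_sup; last first.
  exists ((N v)^-1 *: v) => //=.
  by rewrite (is_norm_homog hN) gtr0_norm ?invr_gt0 // mulVf ?lt0r_neq0.
have [c c0 cN] := norm_le_is_norm hN.
exists ((\sum_(i < d) `|u ord0 i|) * c^-1) => _ [w /= w1 <-].
apply: le_trans (dotp_le_sum _ _) _; rewrite ler_wpM2l ?sumr_ge0 //.
by rewrite -[leRHS]mulr1 ler_pdivlMl // (le_trans (cN w)).
Qed.

(** * Convexity and smoothness along segments *)

Lemma segment_sub (R : realType) (d : nat) (y z : 'rV[R]_d) (t : R) :
  (1 - t) *: y + t *: z - y = t *: (z - y).
Proof.
by rewrite scalerBl scale1r scalerBr addrAC (addrAC y) subrr add0r addrC.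
Qed.

Lemma convex_set_segment (R : realType) (d : nat) (X : set 'rV[R]_d)
    (y z : 'rV[R]_d) (t : R) :
  convex_set X -> X y -> X z -> 0 <= t <= 1 -> X ((1 - t) *: y + t *: z).
Proof.
move=> Xc Xy Xz /andP[t0 t1].
have /set_mem := Xc z y (Itv01 t0 t1) (mem_set Xz) (mem_set Xy).
by rewrite /conv /= addrC.
Qed.

Lemma convex_function_segment (R : realType) (d : nat) (X : set 'rV[R]_d)
    (f : 'rV[R]_d -> R) (y z : 'rV[R]_d) (t : R) :
  convex_function X f -> X y -> X z -> 0 <= t <= 1 ->
  f ((1 - t) *: y + t *: z) <= (1 - t) * f y + t * f z.
Proof.
move=> fc Xy Xz /andP[t0 t1].
have := fc (Itv01 t0 t1) z y (mem_set Xz) (mem_set Xy).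
by rewrite /conv /= addrC [leRHS]addrC.
Qed.

(** If [f z] lay below the tangent by [c], convexity would put [f] below it by at least [t * c] at
    parameter [t] of the segment, a linear defect that the little-o remainder excludes. *)
Lemma convex_gradient_le (R : realType) (d : nat) (X : set 'rV[R]_d)
    (f : 'rV[R]_d -> R) (y z p : 'rV[R]_d) :
  convex_set X -> convex_function X f -> gradient_on X f y p ->
  X y -> X z -> f y + dotp p (z - y) <= f z.
Proof.
move=> Xc fc fp Xy Xz; rewrite leNgt; apply/negP => gap.
pose c := f y + dotp p (z - y) - f z; have c0 : 0 < c by rewrite subr_gt0.
(* Chosen so that [e] times the length of the segment is below [c]; the added 1 covers [z = y]. *)
pose e := c / (2 * (`|z - y| + 1)).
have n0 : 0 < `|z - y| + 1 by rewrite ltr_wpDl.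
have e0 : 0 < e by rewrite divr_gt0 // mulr_gt0.
move: fp => /eqoP /(_ _ e0); rewrite near_withinE => /nbhs_ballP[r /= r0 small].
pose t := Num.min 1 (r / (2 * (`|z - y| + 1))).
have t0 : 0 < t by rewrite lt_min ltr01 divr_gt0 // mulr_gt0.
have t1 : t <= 1 by rewrite ge_min lexx.
have t01 : 0 <= t <= 1 by rewrite ltW.
have near_y : ball y r ((1 - t) *: y + t *: z).
  rewrite -ball_normE /ball_ /= distrC segment_sub normrZ gtr0_norm //.
  apply: (@le_lt_trans _ _ (r / (2 * (`|z - y| + 1)) * `|z - y|)).
    by rewrite ler_wpM2r // ge_min lexx orbT.
  rewrite mulrAC ltr_pdivrMr ?mulr_gt0 // ltr_pM2l //.
  by have := normr_ge0 (z - y); lra.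
have := small _ near_y (convex_set_segment Xc Xy Xz t01).
rewrite segment_sub normrZ gtr0_norm // dotpZr ler_norml => /andP[lo _].
have up := convex_function_segment fc Xy Xz t01.
have : e * (t * `|z - y|) < t * c.
  rewrite mulrCA ltr_pM2l // /e mulrAC ltr_pdivrMr ?mulr_gt0 // ltr_pM2l //.
  by have := normr_ge0 (z - y); lra.
by rewrite /c; lra.
Qed.

(* Applying the first-order inequality of convexity at the right endpoints of
   [n+1] equal subsegments and summing gives the bound with [1/2 + 1/(2(n+1))]
   in place of [1/2]; this avoids integrating the gradient along the segment,
   where [f] has only a derivative relative to [X]. *)
Lemma lipschitz_gradient_le (R : realType) (d : nat) (N : 'rV[R]_d -> R)
    (X : set 'rV[R]_d) (L : R) (f : 'rV[R]_d -> R)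
    (gradf : 'rV[R]_d -> 'rV[R]_d) (y z : 'rV[R]_d) :
  is_norm N -> convex_set X -> convex_function X f -> 0 <= L ->
  (forall w, X w -> gradient_on X f w (gradf w)) ->
  (forall w w', X w -> X w' ->
    dual_norm N (gradf w - gradf w') <= L * N (w - w')) ->
  X y -> X z ->
  f z <= f y + dotp (gradf y) (z - y) + L * N (z - y) ^+ 2 / 2.
Proof.
move=> hN Xc fc L0 fd fL Xy Xz; set h := z - y; set A := dotp (gradf y) h.
set C := L * N h ^+ 2.
(* The division points of the segment into [n.+1] equal parts. *)
pose p (n k : nat) := y + (k%:R / n.+1%:R) *: h.
have Xp n k : (k <= n.+1)%N -> X (p n k).
  move=> kn.
  have -> : p n k = (1 - k%:R / n.+1%:R) *: y + (k%:R / n.+1%:R) *: z.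
    by rewrite /p /h scalerBl scale1r scalerBr addrA addrAC.
  apply: convex_set_segment => //; rewrite divr_ge0 //= ler_pdivrMr ?ltr0n //.
  by rewrite mul1r ler_nat.
have step n k : (k < n.+1)%N ->
    f (p n k.+1) - f (p n k) <= A / n.+1%:R + C * k.+1%:R / n.+1%:R ^+ 2.
  move=> kn; have m0 : 0 < n.+1%:R :> R by rewrite ltr0n.
  have Xk := Xp n k (ltnW kn); have Xk1 := Xp n k.+1 kn.
  have := convex_gradient_le Xc fc (fd _ Xk1) Xk1 Xk.
  have -> : p n k - p n k.+1 = (- n.+1%:R^-1) *: h.
    rewrite /p opprD addrACA subrr add0r -scalerBl; congr (_ *: _).
    by rewrite -mulrBl -natr1 opprD addrA subrr add0r mulN1r.
  (* Duality and the Lipschitz condition control how far the slope at the right endpoint exceeds the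
     slope at [y]. *)
  have : dotp (gradf (p n k.+1) - gradf y) h
      <= L * (k.+1%:R / n.+1%:R * N h) * N h.
    apply: le_trans (dotp_le_dual_norm _ _ hN) _.
    apply: ler_wpM2r; first exact: is_norm_ge0.
    apply: le_trans (fL _ _ Xk1 Xy) _.
    by rewrite /p addrAC subrr add0r is_norm_homog // ger0_norm ?divr_ge0.
  rewrite dotpBl dotpZr -/A => gk fk.
  have -> : C * k.+1%:R / n.+1%:R ^+ 2
      = L * (k.+1%:R / n.+1%:R * N h) * N h / n.+1%:R.
    by rewrite /C; field; rewrite lt0r_neq0.
  rewrite -mulrDl; set G := dotp (gradf (p n k.+1)) h in gk fk.
  apply: (@le_trans _ _ (G / n.+1%:R)); last first.
    by rewrite ler_pM2r ?invr_gt0 // -lerBlDl.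
  by rewrite mulNr in fk; rewrite lerBlDr addrC -lerBlDr [G / _]mulrC.
have sum_step n m : (m <= n.+1)%N ->
    f (p n m) - f y <= m%:R * (A / n.+1%:R)
      + C * (m%:R * m.+1%:R / 2) / n.+1%:R ^+ 2.
  elim: m => [_|m IH mn].
    by rewrite /p !mul0r scale0r addr0 subrr mulr0 mul0r addr0.
  have := IH (ltnW mn); have := step n m mn.
  have -> : C * (m.+1%:R * m.+2%:R / 2) / n.+1%:R ^+ 2
      = C * (m%:R * m.+1%:R / 2) / n.+1%:R ^+ 2 + C * m.+1%:R / n.+1%:R ^+ 2.
    by field; rewrite nat1r pnatr_eq0.
  move=> st IHm; rewrite -[in X in _ <= X * _ + _](natr1 m) mulrDl mul1r.
  by rewrite addrACA -(subrKA (f (p n m))) addrC; apply: lerD.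
have bound n : f z - f y - A - C / 2 <= C / 2 / n.+1%:R.
  have := sum_step n n.+1 (leqnn _).
  have -> : p n n.+1 = z.
    by rewrite /p divff ?pnatr_eq0 // scale1r /h addrC subrK.
  have -> : n.+1%:R * (A / n.+1%:R) + C * (n.+1%:R * n.+2%:R / 2) / n.+1%:R ^+ 2
      = A + C / 2 + C / 2 / n.+1%:R.
    by field; rewrite nat1r pnatr_eq0.
  move=> bd; rewrite 2!lerBlDr; apply: le_trans bd _.
  by rewrite [leRHS]addrC (addrC (C / 2 / n.+1%:R)) addrA.
suff : f z - f y - A - C / 2 <= 0 by lra.
rewrite leNgt; apply/negP => gap.
(* A positive excess would be beaten by [C / 2 / n.+1%:R] for [n] large, by the Archimedean
   property. *)
have := truncnS_gt (C / 2 / (f z - f y - A - C / 2)).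
rewrite ltr_pdivrMr // -ltr_pdivrMl ?ltr0n // [ltLHS]mulrC.
by rewrite ltNge bound.
Qed.

(** * Recursions for the weights and for [Phi] *)

Lemma hb_weightS (R : realType) (delta : nat -> R) (k tau : nat) :
  (tau <= k)%N ->
  hb_weight delta k.+1 tau = (1 - delta k.+1) * hb_weight delta k tau.
Proof.
move=> tk; rewrite /hb_weight; case: eqP => _.
  by rewrite big_nat_recr //= mulrC.
by rewrite big_nat_recr //= mulrA mulrC.
Qed.

Lemma hb_weight_diag (R : realType) (delta : nat -> R) (k : nat) :
  hb_weight delta k.+1 k.+1 = delta k.+1.
Proof. by rewrite /hb_weight /= big_geq // mulr1. Qed.

Lemma Phi1 (R : realType) (d : nat) (f : 'rV[R]_d -> R)
    (gradf : 'rV[R]_d -> 'rV[R]_d) (delta : nat -> R) (x : nat -> 'rV[R]_d)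
    (z : 'rV[R]_d) :
  Phi f gradf delta x 1 z = f (x 0) + dotp (gradf (x 0)) (z - x 0).
Proof. by rewrite /Phi big_nat1 /hb_weight /= big_geq // mul1r. Qed.

Lemma PhiS (R : realType) (d : nat) (f : 'rV[R]_d -> R)
    (gradf : 'rV[R]_d -> 'rV[R]_d) (delta : nat -> R) (x : nat -> 'rV[R]_d)
    (k : nat) (z : 'rV[R]_d) :
  Phi f gradf delta x k.+2 z = (1 - delta k.+1) * Phi f gradf delta x k.+1 z
    + delta k.+1 * (f (x k.+1) + dotp (gradf (x k.+1)) (z - x k.+1)).
Proof.
rewrite /Phi big_nat_recr //= hb_weight_diag mulr_sumr; congr (_ + _).
by apply: eq_big_nat => tau /andP[_ tk]; rewrite hb_weightS // mulrA.
Qed.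

(** * Feasibility of the iterates and minimization of [Phi] *)

Section iterates.
Context (R : realType) (d : nat) (X : set 'rV[R]_d) (f : 'rV[R]_d -> R).
Context (gradf : 'rV[R]_d -> 'rV[R]_d) (delta eta : nat -> R).
Context (x g v : nat -> 'rV[R]_d).
Context (hHFW : HFW X gradf delta eta x g v).

Lemma HFW_mem_v k : X (v k.+1).
Proof. by have [] := HFW_v hHFW k. Qed.

Lemma HFW_mem_x k : convex_set X -> X (x k).
Proof.
move=> Xc; elim: k => [|k IH]; first exact: HFW_x0 hHFW.
rewrite (HFW_x hHFW); apply: convex_set_segment => //; first exact: HFW_mem_v.
exact: HFW_eta hHFW k.
Qed.

(** The slope of [Phi] and the momentum [g] obey the same recursion. They start alike whatever
    [delta 0] is, since [g 0 = gradf (x 0)] forces [g 1 = gradf (x 0)]. *)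
Lemma Phi_sub k (y z : 'rV[R]_d) :
  Phi f gradf delta x k.+1 y - Phi f gradf delta x k.+1 z
    = dotp (g k.+1) (y - z).
Proof.
elim: k => [|k IH].
  rewrite !Phi1 (HFW_g hHFW) (HFW_g0 hHFW) -scalerDl subrK scale1r.
  by rewrite !dotpBr; ring.
by rewrite !PhiS (HFW_g hHFW k.+1) dotpDl !dotpZl -IH !dotpBr; ring.
Qed.

Lemma Phi_argmin k z :
  X z -> Phi f gradf delta x k.+1 (v k.+1) <= Phi f gradf delta x k.+1 z.
Proof.
move=> Xz; rewrite -subr_ge0 Phi_sub dotpBr subr_ge0.
by have [_] := HFW_v hHFW k; apply.
Qed.

(** The infimum in the gap is attained at [v k.+1]. *)
Lemma fw_gapE k :
  fw_gap X f gradf delta x k.+1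
    = f (x k.+1) - Phi f gradf delta x k.+1 (v k.+1).
Proof.
pose m := Phi f gradf delta x k.+1 (v k.+1).
have m_lb : lbound [set Phi f gradf delta x k.+1 z | z in X] m.
  by move=> _ [z Xz <-]; exact: Phi_argmin.
have m_in : [set Phi f gradf delta x k.+1 z | z in X] m.
  by exists (v k.+1) => //; exact: HFW_mem_v.
congr (_ - _); apply/eqP; rewrite eq_le; apply/andP; split.
  by apply: ge_inf => //; exists m.
by apply: lb_le_inf => //; exists m.
Qed.

End iterates.

(** * Descent by line search and the rate *)

Theorem theorem6 (R : realType) (d : nat) (N : 'rV[R]_d -> R)
    (X : set 'rV[R]_d) (D L : R)
    (f : 'rV[R]_d -> R) (gradf : 'rV[R]_d -> 'rV[R]_d)
    (delta eta : nat -> R) (x g v : nat -> 'rV[R]_d)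
    (hN : is_norm N)
    (hX0 : X !=set0) (hXconvex : convex_set X) (hXcompact : compact X)
    (hD : forall y z, X y -> X z -> N (y - z) <= D)
    (hfconvex : convex_function X f)
    (hfdiff : forall y, X y -> gradient_on X f y (gradf y))
    (hL0 : 0 <= L)
    (hL : forall y z, X y -> X z ->
      dual_norm N (gradf y - gradf z) <= L * N (y - z))
    (hHFW : HFW X gradf delta eta x g v)
    (hdelta : forall k : nat, delta k = 2 / (k%:R + 2))
    (heta : forall k : nat,
      argmin `[0, 1]%classic
        (fun h : R => f ((1 - h) *: x k + h *: v k.+1)) (eta k)) :
  forall k : nat, (1 <= k)%N ->
    fw_gap X f gradf delta x k = f (x k) - Phi f gradf delta x k (v k) /\
    f (x k) - Phi f gradf delta x k (v k) <= 2 * L * D ^+ 2 / (k%:R + 1).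
Proof.
case=> [//|k] _; split; first exact: fw_gapE hHFW k.
have Xx j : X (x j) := HFW_mem_x hHFW j hXconvex.
have Xv j : X (v j.+1) := HFW_mem_v hHFW j.
(* The line search does at least as well as any fixed step [t], to which the quadratic bound
   applies, with [N (v j.+1 - x j)] at most [D]. *)
have descent j (t : R) : 0 <= t <= 1 ->
    f (x j.+1) <= f (x j) + t * dotp (gradf (x j)) (v j.+1 - x j)
      + t ^+ 2 * (L * D ^+ 2 / 2).
  move=> t01; have [t0 _] := andP t01.
  have Xt := convex_set_segment hXconvex (Xx j) (Xv j) t01.
  have [_ /(_ t)] := heta j; rewrite -(HFW_x hHFW) /= in_itv /= => /(_ t01).
  move=> /le_trans; apply.
  have := lipschitz_gradient_le hN hXconvex hfconvex hL0 hfdiff hL (Xx j) Xt.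
  rewrite segment_sub dotpZr (is_norm_homog hN) ger0_norm //.
  move=> /le_trans; apply.
  rewrite lerD2l exprMn mulrCA -[leLHS]mulrA ler_wpM2l ?sqr_ge0 //.
  rewrite ler_wpM2r ?invr_ge0 // ler_wpM2l //.
  have Nge0 := is_norm_ge0 (v j.+1 - x j) hN.
  by rewrite ler_sqr ?nnegrE ?(le_trans Nge0) ?hD.
have B0 : 0 <= L * D ^+ 2 by rewrite mulr_ge0 // sqr_ge0.
elim: k => [|k IH].
  (* With the full step [t = 1] the linear part is exactly [Phi] of index 1 at [v 1], so the first
     gap is at most half of the claimed [L * D ^+ 2]. *)
  have := descent 0 1; rewrite lexx ler01 => /(_ isT).
  rewrite Phi1 expr1n !mul1r => d1.
  apply: (@le_trans _ _ (L * D ^+ 2 / 2)).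
    by rewrite lerBlDr addrC.
  by rewrite -mulrA ler_pdivlMr; lra.
set G := f (x k.+1) - _ in IH.
have rec : f (x k.+2) - Phi f gradf delta x k.+2 (v k.+2)
    <= (1 - delta k.+1) * G + delta k.+1 ^+ 2 * (L * D ^+ 2 / 2).
  have d01 := HFW_delta hHFW k.+1; have [d0 d1] := andP d01.
  (* The new point [v k.+2] is tested against the old minimizer [v k.+1], so the old model loses
     nothing when evaluated at the new point. *)
  have := Phi_argmin f hHFW k (Xv k.+1); rewrite -subr_ge0 => min.
  have : 0 <= (1 - delta k.+1) * (Phi f gradf delta x k.+1 (v k.+2)
      - Phi f gradf delta x k.+1 (v k.+1)) by rewrite mulr_ge0 // subr_ge0.
  by have := descent k.+1 _ d01; rewrite PhiS /G; lra.
apply: le_trans rec _.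
have k0 : 0 <= k%:R :> R by [].
have dE : 1 - delta k.+1 = (k%:R + 1) / (k%:R + 3).
  by rewrite hdelta -natr1; field; lra.
apply: (@le_trans _ _
    ((k%:R + 1) / (k%:R + 3) * (2 * L * D ^+ 2 / (k.+1%:R + 1))
    + delta k.+1 ^+ 2 * (L * D ^+ 2 / 2))).
  by rewrite lerD2r dE ler_wpM2l // divr_ge0 //; lra.
rewrite -subr_ge0.
(* With [delta k.+1 = 2 / (k + 3)], the induction closes with this explicit nonnegative slack. *)
have -> : 2 * L * D ^+ 2 / (k.+2%:R + 1) - ((k%:R + 1) / (k%:R + 3) *
    (2 * L * D ^+ 2 / (k.+1%:R + 1)) + delta k.+1 ^+ 2 * (L * D ^+ 2 / 2))
  = 2 * (L * D ^+ 2) / ((k%:R + 2) * (k%:R + 3) ^+ 2).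
  by rewrite hdelta -!natr1; field; repeat split; lra.
by apply: divr_ge0; apply: mulr_ge0; rewrite ?exprn_ge0 ?addr_ge0.
Qed.
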